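(* Let $d\ge 3$, let $D$ be a finite subset of $\mathbb{Z}^d$ and let $C$ be a closed convex subset of $\ell^1(D)$. For any integer $t\ge1$, $$\inf_{x\in\overline{D}}P_x\Big(\frac1t L^D_t\in C,\ \tau(D,t)<\infty\Big)\le\exp\Big(-t\inf_{h\in C,\,h\ge0}\frac12\mathcal{E}(\sqrt h,D)\Big).$$
   Context: $P_x$ is the law of the discrete-time simple random walk $(S_k)_{k\ge0}$ on $\mathbb{Z}^d$ started at $x$. $L_k(y)=\sum_{j=0}^{k-1}1_{\{S_j=y\}}$ and $L_k(D)=\sum_{y\in D}L_k(y)$. For $t\in\mathbb{N}$, $\tau(D,t)=\inf\{k\ge1: L_k(D)=t\}$, and $L^D_t$ is the function on $D$ given by $L^D_t(x)=L_{\tau(D,t)}(x)$. $\ell^1(D)$ is equipped with the norm $\|f\|_{1,D}=\sum_{x\in D}|f(x)|$. $\overline D=D\cup\{x\in\mathbb{Z}^d:\exists y\in D,\ |x-y|=1\}$. For $f:D\to\mathbb{R}$, $\mathcal{E}(f,D)=\frac{1}{2d}\sum_{y,z\in D,\ |y-z|=1}(f(y)-f(z))^2$ (sum over ordered pairs). The infimum over an empty set is $+\infty$. *)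

(* Defs.v *)
From HB Require Import structures.
From mathcomp Require Import all_boot all_order all_algebra.
From mathcomp Require Import finmap.
From mathcomp Require Import all_classical all_reals all_analysis.
Set Implicit Arguments. Unset Strict Implicit. Unset Printing Implicit Defensive.
Import Order.TTheory GRing.Theory Num.Theory.
Local Open Scope ring_scope.

Notation pt d := 'rV[int]_d.

Definition adj d (x y : pt d) : bool := (\sum_(i < d) (x 0 i - y 0 i) ^+ 2 == 1).

Definition Dbar d (D : {fset pt d}) : set (pt d) :=
  [set x | x \in D \/ exists2 y, y \in D & adj x y].

Definition step d := ('I_d * bool)%type.
Definition unitv d (st : step d) : pt d :=
  if st.2 then delta_mx 0 st.1 else - delta_mx 0 st.1.

(* Given x and the first n steps s, walk x s j = S_j for j <= n. *)
Definition walk d n (x : pt d) (s : {ffun 'I_n -> step d}) (j : nat) : pt d :=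
  x + \sum_(i < n | (i < j)%N) unitv (s i).

(* L_k(y) = sum_{j<k} 1_{S_j = y} (meaningful for k <= n+1) *)
Definition loc d n (x : pt d) (s : {ffun 'I_n -> step d}) (k : nat) (y : pt d) : nat :=
  (\sum_(j < k) (walk x s j == y))%N.

Definition locD d n (x : pt d) (s : {ffun 'I_n -> step d}) (D : {fset pt d}) (k : nat) : nat :=
  (\sum_(y : D) loc x s k (fsval y))%N.

Definition tau_is d n (x : pt d) (s : {ffun 'I_n -> step d}) (D : {fset pt d}) (t k : nat) : Prop :=
  (1 <= k)%N /\ locD x s D k = t /\ (forall k', (1 <= k')%N -> (k' < k)%N -> locD x s D k' <> t).

Definition l1norm (R : realType) d (D : {fset pt d}) (f : {ffun D -> R}) : R :=
  \sum_(y : D) `|f y|.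

Definition l1_closed (R : realType) d (D : {fset pt d}) (C : set {ffun D -> R}) : Prop :=
  forall g, ~ C g -> exists2 e : R, 0 < e &
    forall f : {ffun D -> R}, l1norm [ffun y => f y - g y] < e -> ~ C f.

Definition l1_convex (R : realType) d (D : {fset pt d}) (C : set {ffun D -> R}) : Prop :=
  forall (f g : {ffun D -> R}) (l : R), C f -> C g -> 0 <= l -> l <= 1 ->
    C [ffun y => l * f y + (1 - l) * g y].

Definition energy (R : realType) d (D : {fset pt d}) (f : {ffun D -> R}) : R :=
  (2 * d)%:R^-1 * \sum_(y : D) \sum_(z : D | adj (fsval y) (fsval z)) (f y - f z) ^+ 2.

Definition sqrtf (R : realType) d (D : {fset pt d}) (h : {ffun D -> R}) : {ffun D -> R} :=
  [ffun y => Num.sqrt (h y)].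

(* The event {tau(D,t) = n+1, L^D_t / t in C} for the path x, S_1, ..., S_n
   determined by the n steps s (it only depends on these first n steps). *)
Definition event (R : realType) d (D : {fset pt d}) (C : set {ffun D -> R}) (t : nat)
  (x : pt d) n (s : {ffun 'I_n -> step d}) : Prop :=
  tau_is x s D t n.+1 /\
  C [ffun y : D => (loc x s n.+1 (fsval y))%:R / t%:R].

(* P_x( L^D_t / t in C, tau(D,t) < oo ) for the simple random walk started at x:
   sum over the disjoint events {tau = n+1}, each a union of cylinders of n steps,
   each of probability (2d)^{-n}. *)
Definition Pevent (R : realType) d (D : {fset pt d}) (C : set {ffun D -> R}) (t : nat)
  (x : pt d) : \bar R :=
  (\sum_(n <oo) (\sum_(s : {ffun 'I_n -> step d} | `[< event C t x s >])
                   (((2 * d)%:R : R) ^- n)%:E))%E.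

(* Main.v *)
Require Import Defs.
From HB Require Import structures.
From mathcomp Require Import all_boot all_order all_algebra.
From mathcomp Require Import finmap.
From mathcomp Require Import all_classical all_reals all_analysis.
From mathcomp Require Import ring lra zify.
Import Order.TTheory GRing.Theory Num.Theory.
Import numFieldNormedType.Exports.
Local Open Scope classical_set_scope.
Local Open Scope ring_scope.
Set Implicit Arguments. Unset Strict Implicit. Unset Printing Implicit Defensive.

(** Let P be the transition operator of the walk killed outside a finite box
    that contains every point reachable from the closure of D in N steps. Minimise
    the Dirichlet form <u, u - Pu> over the functions u >= 0 on the box such that
    u^2 - h^2 restricted to D is a probability vector of C, where h > 0 is small.
    Optimality off D makes the minimiser u superharmonic there, and optimality on D
    says that, up to an error vanishing with h, every probability vector k of C
    satisfies
      sum_D k (1 - Pu/u) >= <u, u - Pu> >= inf_C E(sqrt h, D) / 2 =: e0.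
    With phi = 1 - Pu/u on D and phi = 0 off D, the inequality x <= exp(x - 1) shows
    that exp(sum_{j<n} phi(S_j)) u(S_n) is a supermartingale. Stop it at the t-th
    visit to D, having started at a minimum x of u on the closure of D: then
    Pu(S_n) >= u(x) at the stopping time, so the expectation of
    exp(t sum_D k phi), with k = L^D_t / t, is at most 1, and on the event this
    exponential is at least exp(t e0). *)

(** * A variational problem for the Dirichlet form of a finite kernel *)

(** The pairing [<u, v - Pv>]. Row sums of [p] below 1 stand for killing. *)
Definition dirichlet (R : realType) (I : finType) (p : I -> I -> R) (u v : I -> R) : R :=
  \sum_i u i * (v i - \sum_j p i j * v j).

Lemma dirichlet_sym (R : realType) (I : finType) (p : I -> I -> R) (u v : I -> R) :
  (forall i j, p i j = p j i) -> dirichlet p u v = dirichlet p v u.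
Proof.
move=> psym; rewrite /dirichlet.
under eq_bigr do rewrite mulrBr mulr_sumr.
under [RHS]eq_bigr do rewrite mulrBr mulr_sumr.
rewrite !sumrB [X in _ - X]exchange_big /=; congr (_ - _).
  by apply: eq_bigr => i _; rewrite mulrC.
by apply: eq_bigr => i _; apply: eq_bigr => j _; rewrite psym; ring.
Qed.

(** A factor [s] is pulled out of the increment so that it can be divided away before [s] tends to
    0. *)
Lemma dirichlet_perturb (R : realType) (I : finType) (p : I -> I -> R) (u r : I -> R) (s : R) :
  (forall i j, p i j = p j i) ->
  dirichlet p (fun i => u i + s * r i) (fun i => u i + s * r i) =
  dirichlet p u u + s * (2 * dirichlet p r u + s * dirichlet p r r).
Proof.
move=> psym.
have -> : 2 * dirichlet p r u = dirichlet p r u + dirichlet p u r.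
  by rewrite (dirichlet_sym u r psym) mulr2n mulrDl mul1r.
rewrite /dirichlet !mulrDr !mulr_sumr -!big_split /=; apply: eq_bigr => i _.
have -> : \sum_j p i j * (u j + s * r j) = \sum_j p i j * u j + s * \sum_j p i j * r j.
  by rewrite mulr_sumr -big_split /=; apply: eq_bigr => j _; ring.
ring.
Qed.

(** By symmetry, half the sum over all pairs equals the sum of [(\sum_j p i j) * u i ^+ 2] minus
    [<u, Pu>]. Row sums at most 1 put this below the form, and restricting to pairs in [D] only
    drops nonnegative terms. *)
Lemma dirichlet_ge (R : realType) (I : finType) (p : I -> I -> R) (u : I -> R) (D : {set I}) :
  (forall i j, p i j = p j i) -> (forall i j, 0 <= p i j) -> (forall i, \sum_j p i j <= 1) ->
  2^-1 * (\sum_(i in D) \sum_(j in D) p i j * (u i - u j) ^+ 2) <= dirichlet p u u.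
Proof.
move=> psym p0 p1.
have sum_le (F : I -> R) : (forall i, 0 <= F i) -> \sum_(i in D) F i <= \sum_i F i.
  by move=> F0; rewrite big_mkcond /=; apply: ler_sum => i _; case: ifP.
have sq0 i j : 0 <= p i j * (u i - u j) ^+ 2 by rewrite mulr_ge0 ?sqr_ge0.
apply: (@le_trans _ _ (2^-1 * (\sum_i \sum_j p i j * (u i - u j) ^+ 2))).
  rewrite ler_wpM2l ?invr_ge0//; apply: (@le_trans _ _ (\sum_(i in D) \sum_j p i j * (u i - u j) ^+ 2)).
    by apply: ler_sum => i _; exact: sum_le.
  by apply: sum_le => i; apply: sumr_ge0.
have -> : \sum_i \sum_j p i j * (u i - u j) ^+ 2 =
    2 * \sum_i (\sum_j p i j) * u i ^+ 2 - 2 * \sum_i u i * \sum_j p i j * u j.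
  have e1 : \sum_i (\sum_j p i j) * u i ^+ 2 = \sum_i \sum_j p i j * u i ^+ 2.
    by apply: eq_bigr => i _; rewrite mulr_suml.
  have e2 : \sum_i (\sum_j p i j) * u i ^+ 2 = \sum_i \sum_j p i j * u j ^+ 2.
    by rewrite e1 exchange_big /=; apply: eq_bigr => i _; apply: eq_bigr => j _; rewrite psym.
  rewrite mulr2n 2!mulrDl !mul1r {1}e1 e2 opprD addrA -!sumrN.
  rewrite -!big_split /=; apply: eq_bigr => i _.
  by rewrite mulr_sumr -!sumrN -!big_split /=; apply: eq_bigr => j _; ring.
rewrite mulrBr !mulrA mulVf ?pnatr_eq0// !mul1r /dirichlet.
under [leRHS]eq_bigr do rewrite mulrBr.
rewrite sumrB lerD2r; apply: ler_sum => i _.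
by rewrite -expr2 -[leRHS]mul1r ler_wpM2r ?sqr_ge0.
Qed.

Lemma ge0_continuous_at0 (R : realType) (F : R -> R) :
  {for 0, continuous F} -> (forall s, 0 < s <= 1 -> 0 <= F s) -> 0 <= F 0.
Proof.
move=> cF F0; have cF' : F x @[x --> 0^'+] --> F 0 by apply: cvg_at_right_filter.
apply: (cvgr_to_ge cF'); near=> s; apply: F0; apply/andP; split => //.
near: s; apply: nbhs_right_le; exact: ltr01.
Unshelve. all: end_near. Qed.

Lemma cvg_dirichlet (R : realType) (I : finType) (p : I -> I -> R) (T : Type)
    (F : set_system T) (f g : T -> I -> R) (a b : I -> R) :
  Filter F -> (forall i, f x i @[x --> F] --> a i) -> (forall i, g x i @[x --> F] --> b i) ->
  dirichlet p (f x) (g x) @[x --> F] --> dirichlet p a b.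
Proof.
move=> FF cf cg; apply: cvg_big => [|i _]; first exact: add_continuous.
apply: cvgM; first exact: cf.
apply: cvgB; first exact: cg.
apply: cvg_big => [|j _]; first exact: add_continuous.
by apply: cvgM; [exact: cvg_cst|exact: cg].
Qed.

(** The box [[0, M]^I] is compact by Tychonoff and the constraint is closed in the pointwise
    topology, so the continuous form attains its minimum. *)
Lemma dirichlet_minimizer (R : realType) (I : finType) (p : I -> I -> R)
    (K : set (I -> R)) (sh : I -> R -> R) (M : R)
    (S := [set u : I -> R | (forall i, 0 <= u i <= M) /\ K (fun i => sh i (u i))]) :
  (forall i, continuous (sh i)) ->
  (forall g, ~ K g -> exists2 e, 0 < e & forall f, \sum_i `|f i - g i| < e -> ~ K f) ->
  S !=set0 ->
  exists2 u, S u & forall v, S v -> dirichlet p u u <= dirichlet p v v.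
Proof.
move=> csh Kcl S0.
pose X : set {ptws I -> R} := [set u | forall i, [set` `[0, M]%R] (u i)].
pose Y : set {ptws I -> R} := [set u | K (fun i => sh i (u i))].
have cu (u : {ptws I -> R}) i : (v i @[v --> u] --> u i).
  by apply: (@proj_continuous _ (fun _ : I => R)).
have FF (u : {ptws I -> R}) : Filter (nbhs u) by exact: nbhs_filter.
have cX : compact X.
  exact: (@tychonoff I (fun=> R) (fun=> [set` `[0, M]%R]) (fun=> @segment_compact R 0 M)).
have cY : closed Y.
  rewrite -openC openE => u /= nK; have [e e0 He] := Kcl _ nK.
  have cvg0 : \sum_i `|sh i (v i) - sh i (u i)| @[v --> u] -->
      \sum_i `|sh i (u i) - sh i (u i)|.
    apply: cvg_big => [|i _]; first exact: add_continuous.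
    apply: cvg_norm; apply: cvgB; last exact: cvg_cst.
    by apply: (cvg_comp _ _ (cu u i)); exact: csh.
  rewrite [X in _ --> X]big1 in cvg0; last by move=> i _; rewrite subrr normr0.
  by apply: filterS (cvgr_lt _ cvg0 _ e0) => v; exact: He.
have XY : X `&` Y = S.
  by rewrite predeqE => u; split => -[h1 h2]; split => // i; have := h1 i; rewrite /= in_itv.
have cXY : compact (X `&` Y) by exact: compact_closedI.
have [||u] := @compact_EVT_min _ R (fun u : {ptws I -> R} => dirichlet p u u) _ _ cXY.
- by rewrite XY.
- apply: continuous_subspaceT => u; by apply: cvg_dirichlet => i; exact: cu.
rewrite XY inE => Su min_u; exists u => // v Sv; apply: min_u; exact: mem_set.
Qed.

(** The direction [r s] may vary with [s], as it does along a path of square roots; only its limit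
    at 0 enters the first-order condition. *)
Lemma dirichlet_variation (R : realType) (I : finType) (p : I -> I -> R)
    (u : I -> R) (r : R -> I -> R) :
  (forall i j, p i j = p j i) -> (forall i, {for 0, continuous (fun s => r s i)}) ->
  (forall s, 0 < s <= 1 -> dirichlet p u u <=
     dirichlet p (fun i => u i + s * r s i) (fun i => u i + s * r s i)) ->
  0 <= dirichlet p (r 0) u.
Proof.
move=> psym cr min_u.
(* [s * F s] is the increase of the form along the path. *)
pose F s := 2 * dirichlet p (r s) u + s * dirichlet p (r s) (r s).
suff : 0 <= F 0 by rewrite /F mul0r addr0 pmulr_rge0.
apply: ge0_continuous_at0 => [|s s01].
  apply: cvgD; apply: cvgM; try exact: cvg_cst; try exact: cvg_id.
    by apply: cvg_dirichlet => i; [exact: cr|exact: cvg_cst].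
  by apply: cvg_dirichlet => i; exact: cr.
have := min_u _ s01; rewrite dirichlet_perturb// lerDl pmulr_rge0//.
by case/andP: s01.
Qed.

(** With [w] the root, [w ^+ 2 <= u ^+ 2 = w ^+ 2 + h ^+ 2 <= (w + h) ^+ 2]. This measures the cost
    of the shift by [h ^+ 2]. *)
Lemma sqrtr_shift_bounds (R : realType) (h u : R) :
  0 <= h -> h <= u -> 0 <= u - Num.sqrt (u ^+ 2 - h ^+ 2) <= h.
Proof.
move=> h0 hu; have w0 := sqrtr_ge0 (u ^+ 2 - h ^+ 2).
have : Num.sqrt (u ^+ 2 - h ^+ 2) ^+ 2 = u ^+ 2 - h ^+ 2.
  by rewrite sqr_sqrtr// subr_ge0 ler_sqr ?nnegrE//; lra.
move: (Num.sqrt _) w0 => w w0 ww; apply/andP; split; nra.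
Qed.

(** The last clause is linear in [k], although the energy is not. First-order conditions at a
    constrained minimiser [u] give it, together with superharmonicity off [D]; [eps] pays for two
    losses of at most [h * #|D|]. *)
Lemma superharmonic_separation (R : realType) (I : finType) (p : I -> I -> R)
    (D : {set I}) (K : set (I -> R)) (e0 eps : R) :
  (forall i j, p i j = p j i) -> (forall i j, 0 <= p i j) -> (forall i, \sum_j p i j <= 1) ->
  K !=set0 ->
  (forall g, ~ K g -> exists2 e, 0 < e & forall f, \sum_i `|f i - g i| < e -> ~ K f) ->
  (forall k l s, K k -> K l -> 0 <= s -> s <= 1 -> K (fun i => s * k i + (1 - s) * l i)) ->
  (forall k i, K k -> 0 <= k i <= 1) ->
  (forall k i, K k -> i \notin D -> k i = 0) ->
  (forall k, K k -> e0 <= 2^-1 * \sum_(i in D) \sum_(j in D)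
      p i j * (Num.sqrt (k i) - Num.sqrt (k j)) ^+ 2) ->
  0 < eps ->
  exists u : I -> R, [/\ forall i, 0 <= u i, forall i, i \in D -> 0 < u i,
    forall i, i \notin D -> \sum_j p i j * u j <= u i &
    forall k, K k -> e0 - eps <= \sum_(i in D) k i * (1 - (\sum_j p i j * u j) / u i)].
Proof.
move=> psym p0 p1 [k0 Kk0] Kcl Kcvx K01 KD Ke eps0.
(* Final bookkeeping: [x] is the first variation, [f] the form, [y] its part on [D], [v] the
   contribution of the shift, and [w = h * #|D|] bounds each loss. *)
have combine (x y v w f : R) : 0 <= x -> v <= w -> f <= y -> e0 - w <= f ->
  w + w <= eps -> e0 - eps <= x + y - v by lra.
(* Twice the size of [D], for the two losses, plus 1 to make [n] positive in all cases. *)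
pose n : R := (#|D|).*2.+1%:R.
have n0 : 0 < n by rewrite ltr0n.
pose h := Num.min 1 (eps / n).
have h0 : 0 < h by rewrite lt_min ltr01 divr_gt0.
have h1 : h <= 1 by rewrite ge_min lexx.
have hn : h * n <= eps by rewrite -ler_pdivlMr// ge_min lexx orbT.
have hh1 : h ^+ 2 <= 1 by rewrite expr_le1// ltW.
(* The shift by [h ^+ 2] keeps the minimiser away from 0 on D, where the square root
   is differentiable. *)
pose sh i (x : R) := if i \in D then x ^+ 2 - h ^+ 2 else 0.
have Knn k i : K k -> 0 <= k i by move=> /(K01 _ i)/andP[].
have Kle1 k i : K k -> k i <= 1 by move=> /(K01 _ i)/andP[].
have sq_le2 (x : R) : x <= 2 -> Num.sqrt x <= 2.
  move=> x2; rewrite -[leRHS]ger0_norm// -sqrtr_sqr ler_sqrt// ?sqr_ge0//.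
  by rewrite (le_trans x2)// expr2; lra.
(* The cap 2 gives compactness and is not binding on [D], where [u ^+ 2 <= 1 + h ^+ 2 <= 2]. *)
have [|||u [ub Ku] umin] := @dirichlet_minimizer _ _ p K sh 2.
- move=> i x; rewrite /sh; case: (i \in D); last exact: cvg_cst.
  by apply: cvgB; [exact: exprn_continuous|exact: cvg_cst].
- exact: Kcl.
- exists (fun i => if i \in D then Num.sqrt (k0 i + h ^+ 2) else 0); split => [i|].
    case: ifP => _; rewrite ?lexx ?ler0n// sqrtr_ge0 sq_le2//.
    by have := Kle1 _ i Kk0; lra.
  suff -> : (fun i => sh i (if i \in D then Num.sqrt (k0 i + h ^+ 2) else 0)) = k0 by [].
  apply/funext => i; rewrite /sh; case: (boolP (i \in D)) => iD; last by rewrite (KD _ _ Kk0).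
  by rewrite sqr_sqrtr ?addrK// addr_ge0 ?sqr_ge0 ?Knn.
have u0 i : 0 <= u i by have /andP[] := ub i.
have uD i : i \in D -> h <= u i.
  move=> iD; have := Knn _ i Ku; rewrite /sh iD subr_ge0 ler_sqr ?nnegrE//.
  exact: ltW.
have uD0 i : i \in D -> 0 < u i by move=> /uD; exact: lt_le_trans.
pose Pu i := \sum_j p i j * u j.
have Pu0 i : 0 <= Pu i by apply: sumr_ge0 => j _; rewrite mulr_ge0.
(* Off D the constraint is only [0 <= u i <= 2], so single coordinates may be moved. *)
have var_out i c : i \notin D -> 0 <= u i + c <= 2 -> 0 <= c * (u i - Pu i).
  move=> iD c02.
  have := @dirichlet_variation _ _ p u (fun=> (fun j => if j == i then c else 0)) psym.
  have -> : dirichlet p (fun j => if j == i then c else 0) u = c * (u i - Pu i).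
    rewrite /dirichlet (bigD1 i)//= eqxx [X in _ + X]big1 ?addr0// => j /negbTE ->.
    by rewrite mul0r.
  apply; first by move=> j; exact: cst_continuous.
  move=> s /andP[s0 s1]; apply: umin; split => [j|].
    case: ifP => [/eqP->|_]; last by rewrite mulr0 addr0.
    have /andP[] := ub i; case/andP: c02 => c0 c2 ui0 ui2; apply/andP; split; nra.
  suff -> : (fun j => sh j (u j + s * (if j == i then c else 0))) = (fun j => sh j (u j)) by [].
  apply/funext => j; rewrite /sh; case: ifP => // jD; case: eqP => [ji|_].
    by move: iD; rewrite -ji jD.
  by rewrite mulr0 addr0.
have Pu2 i : Pu i <= 2.
  apply: (@le_trans _ _ (\sum_j p i j * 2)).
    by apply: ler_sum => j _; rewrite ler_wpM2l//; have /andP[] := ub j.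
  by rewrite -mulr_suml; have := p1 i; lra.
(* Raise [u i] towards the cap; if it is already at the cap, [Pu i <= 2] suffices. *)
have sup_out i : i \notin D -> Pu i <= u i.
  move=> iD; have /andP[_ ui2] := ub i.
  have := var_out i (2 - u i) iD; rewrite addrC subrK lexx ler0n => /(_ isT).
  have [u2 _|u2] := eqVneq (u i) 2; first by rewrite u2.
  by rewrite pmulr_rge0 ?subr_ge0// subr_gt0 lt_neqAle u2.
(* Lower [u i] towards 0. Hence sites off [D] contribute nothing positive to the form, which is thus
   at most its part on [D]. *)
have sub_out i : i \notin D -> u i * (u i - Pu i) <= 0.
  move=> iD; have := var_out i (- u i) iD; rewrite addrN lexx ler0n => /(_ isT).
  by rewrite mulNr oppr_ge0.
exists u; split => // k Kk.
(* Move [u ^+ 2] along the segment towards [k]: then [u] moves by exactly [s * r s]. *)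
have var_in : 0 <= \sum_(i in D) (k i - sh i (u i)) * (1 - Pu i / u i).
  pose b i := k i - sh i (u i).
  pose us s i := Num.sqrt (u i ^+ 2 + s * b i).
  (* The quotient [(us s i - u i) / s] with its numerator rationalised, so that it is continuous at
     [s = 0]. *)
  pose r s i := if i \in D then b i / (us s i + u i) else 0.
  have us0 i : us 0 i = u i by rewrite /us mul0r addr0 sqrtr_sqr ger0_norm.
  have := @dirichlet_variation _ _ p u r psym.
  have -> : dirichlet p (r 0) u = 2^-1 * \sum_(i in D) b i * (1 - Pu i / u i).
    rewrite /dirichlet mulr_sumr [RHS]big_mkcond /=; apply: eq_bigr => i _.
    rewrite /r us0; case: ifPn => [iD|_]; last by rewrite mul0r.
    rewrite -/(Pu i); have := uD0 _ iD; move: (u i) (Pu i) (b i) => x y z x0.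
    by field; lra.
  rewrite pmulr_rge0 ?invr_gt0//; apply.
    move=> i; rewrite /r; case: (boolP (i \in D)) => iD; last exact: cvg_cst.
    apply: cvgM; first exact: cvg_cst.
    apply: cvgV; first by rewrite us0 gt_eqF// addr_gt0// uD0.
    apply: cvgD; last exact: cvg_cst.
    apply: (@cvg_comp _ _ _ (fun s => u i ^+ 2 + s * b i) Num.sqrt _
      (nbhs (u i ^+ 2 + 0 * b i))); last exact: sqrt_continuous.
    apply: cvgD; first exact: cvg_cst.
    by apply: cvgM; [exact: cvg_id|exact: cvg_cst].
  move=> s /andP[s0 s1].
  have usE i : i \in D -> u i + s * r s i = us s i.
    move=> iD; rewrite /r iD.
    have us_ge0 : 0 <= us s i := sqrtr_ge0 _.
    have us_sq : us s i ^+ 2 = u i ^+ 2 + s * b i.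
      rewrite /us sqr_sqrtr// /b /sh iD; have := Knn _ i Kk; have := uD _ iD; nra.
    have -> : s * (b i / (us s i + u i)) = (us s i ^+ 2 - u i ^+ 2) / (us s i + u i).
      by rewrite us_sq [u i ^+ 2 + _]addrC addrK mulrA.
    by have ui := uD0 _ iD; field; lra.
  have sqE i : i \in D -> us s i ^+ 2 = h ^+ 2 + (s * k i + (1 - s) * sh i (u i)).
    move=> iD; rewrite /us sqr_sqrtr /b /sh iD; first by ring.
    by have := Knn _ i Kk; have := uD _ iD; nra.
  apply: umin; split => [i|].
    have [iD|iD] := boolP (i \in D); last by rewrite /r (negbTE iD) mulr0 addr0.
    rewrite usE// sqrtr_ge0 sq_le2// /b.
    have := Kle1 _ i Kk; have := Kle1 _ i Ku; have := sqE _ iD.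
    rewrite /us sqr_sqrtr; first by rewrite /b => ->; nra.
    by rewrite /b /sh iD; have := Knn _ i Kk; have := uD _ iD; nra.
  suff -> : (fun i => sh i (u i + s * r s i)) = (fun i => s * k i + (1 - s) * sh i (u i)).
    by apply: Kcvx => //; exact: ltW.
  apply/funext => i; have [iD|iD] := boolP (i \in D).
    by rewrite {1}/sh iD usE// sqE//; ring.
  by rewrite /sh (negbTE iD) (KD _ _ Kk)// !mulr0 addr0.
(* On [D], write [k] as [(k - sh u) + u ^+ 2 - h ^+ 2]; the middle term gives [u * (u - Pu)]. *)
have -> : \sum_(i in D) k i * (1 - Pu i / u i) =
    \sum_(i in D) (k i - sh i (u i)) * (1 - Pu i / u i) +
    \sum_(i in D) u i * (u i - Pu i) - \sum_(i in D) h ^+ 2 * (1 - Pu i / u i).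
  rewrite -big_split -sumrB /=; apply: eq_bigr => i iD; rewrite /sh iD.
  by have := uD0 _ iD; move: (u i) (Pu i) => x y x0; field; lra.
have le_shift : \sum_(i in D) h ^+ 2 * (1 - Pu i / u i) <= h * #|D|%:R.
  apply: (@le_trans _ _ (\sum_(i in D) h)); last by rewrite sumr_const mulr_natr.
  apply: ler_sum => i iD; have : 0 <= Pu i / u i by rewrite divr_ge0.
  by move: (Pu i / u i) => x x0; nra.
have ge_form : dirichlet p u u <= \sum_(i in D) u i * (u i - Pu i).
  rewrite /dirichlet [leRHS]big_mkcond /=; apply: ler_sum => i _.
  by case: ifPn => // /sub_out.
(* Compare the increments [B] of the roots of [sh u] with the increments [A] of [u]: since
   [|A - B| <= h] and [|B| <= 1], [B ^+ 2 - A ^+ 2 <= 2 * h]. Row sums at most 1 and the factor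
   [2^-1] leave [h] for each site of [D]. *)
have ge_energy : e0 - h * #|D|%:R <= dirichlet p u u.
  apply: le_trans (dirichlet_ge u D psym p0 p1).
  have := Ke _ Ku.
  suff : 2^-1 * (\sum_(i in D) \sum_(j in D) p i j * (Num.sqrt (sh i (u i)) - Num.sqrt (sh j (u j))) ^+ 2)
      - h * #|D|%:R <= 2^-1 * (\sum_(i in D) \sum_(j in D) p i j * (u i - u j) ^+ 2) by lra.
  have -> : h * #|D|%:R = \sum_(i in D) h by rewrite sumr_const mulr_natr.
  rewrite !mulr_sumr -sumrB; apply: ler_sum => i iD.
  rewrite lerBlDr -lerBlDl -mulrBr -sumrB.
  have bnd j : j \in D -> p i j * (Num.sqrt (sh i (u i)) - Num.sqrt (sh j (u j))) ^+ 2 -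
      p i j * (u i - u j) ^+ 2 <= p i j * (2 * h).
    move=> jD; rewrite -mulrBr ler_wpM2l//.
    have := sqrtr_shift_bounds (ltW h0) (uD _ iD).
    have := sqrtr_shift_bounds (ltW h0) (uD _ jD).
    have w1 l : Num.sqrt (sh l (u l)) <= 1.
      by rewrite -sqrtr1 ler_sqrt ?ler01//; exact: Kle1 Ku.
    have := w1 i; have := w1 j.
    have := sqrtr_ge0 (sh i (u i)); have := sqrtr_ge0 (sh j (u j)).
    rewrite /sh iD jD; move: (Num.sqrt (u i ^+ 2 - _)) (Num.sqrt (u j ^+ 2 - _)) => y x.
    move=> x0 y0 x1 y1 /andP[uj1 uj2] /andP[ui1 ui2].
    have : `|y - x| <= 1 by rewrite ler_norml; lra.
    have : `|(u i - u j) - (y - x)| <= h by rewrite ler_norml; lra.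
    move: (u i - u j) (y - x) => A B AB B1.
    have -> : B ^+ 2 - A ^+ 2 = - (2 * (B * (A - B))) - (A - B) ^+ 2 by ring.
    have : `|B * (A - B)| <= h by rewrite normrM -[leRHS]mul1r ler_pM.
    by rewrite ler_norml => /andP[+ _]; have := sqr_ge0 (A - B); lra.
  have : \sum_(j in D) (p i j * (Num.sqrt (sh i (u i)) - Num.sqrt (sh j (u j))) ^+ 2 -
      p i j * (u i - u j) ^+ 2) <= \sum_(j in D) p i j * (2 * h) by exact: ler_sum.
  have : \sum_(j in D) p i j * (2 * h) <= \sum_j p i j * (2 * h).
    rewrite big_mkcond /=; apply: ler_sum => j _; case: ifP => // _.
    by rewrite mulr_ge0// mulr_ge0// ltW.
  have : \sum_j p i j * (2 * h) <= 2 * h.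
    by rewrite -mulr_suml -[leRHS]mul1r ler_wpM2r// mulr_ge0// ltW.
  set X := \sum_(j in D) (_ - _); set Y := \sum_(j in D) _; set Z := \sum_j _.
  move: X Y Z => X Y Z; clear; lra.
have hD : h * #|D|%:R + h * #|D|%:R <= eps.
  by rewrite -mulrDr -natrD addnn (le_trans _ hn)// ler_wpM2l ?ler_nat ?leqnSn// ltW.
exact: combine var_in le_shift ge_form ge_energy hD.
Qed.

(** * Lattice walks *)

Lemma unitvE d (a : step d) (i : 'I_d) :
  unitv a 0 i = (if i == a.1 then (-1) ^+ (~~ a.2) else 0).
Proof.
by case: a => j [] /=; rewrite /unitv /= !mxE eqxx /=; case: (i == j); rewrite ?oppr0.
Qed.

Lemma unitv_inj d : injective (@unitv d).
Proof.
move=> [i b] [j c] /matrixP E; have := E 0 i; rewrite !unitvE /= eqxx.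
case: eqVneq => [<-|_]; first by case: b c {E} => -[].
by case: b {E}.
Qed.

(** A nonzero integer coordinate already contributes at least 1, so it is 1 or -1 and all the others
    vanish. *)
Lemma sum_sqr_eq1 d (v : 'rV[int]_d) :
  (\sum_i v 0 i ^+ 2 == 1) = [exists a, v == unitv a].
Proof.
apply/idP/existsP => [/eqP v1|[a /eqP->]]; last first.
  rewrite (bigD1 a.1)//= unitvE eqxx sqrr_sign big1 ?addr0// => i /negbTE ia.
  by rewrite unitvE ia expr0n.
have [i vi] : exists i, v 0 i != 0.
  apply/existsP; apply: contraPT v1 => /existsPn v0.
  by rewrite big1 // => i _; have := v0 i; rewrite negbK => /eqP ->.
move: v1; rewrite (bigD1 i)//=.
set S := \sum_(j | _) _ => v1.
have S0 : 0 <= S by apply: sumr_ge0 => j _; exact: sqr_ge0.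
have vi1 : 1 <= v 0 i ^+ 2 by have := sqr_ge0 (v 0 i); have := expf_neq0 2 vi; lia.
have SE : S = 0 by lia.
have /eqP : v 0 i ^+ 2 = 1 by lia.
rewrite sqrf_eq1 => vi_sign.
exists (i, v 0 i == 1); apply/eqP/rowP => j; rewrite unitvE /=.
case: eqVneq => [->|ji]; first by case/orP: vi_sign => /eqP ->.
move/psumr_eq0P : SE => /(_ (fun k _ => sqr_ge0 _)) /(_ j ji) /eqP.
by rewrite sqrf_eq0 => /eqP.
Qed.

Lemma adjP d (x y : pt d) : reflect (exists a, x = y + unitv a) (adj x y).
Proof.
have -> : adj x y = [exists a, x - y == unitv a].
  by rewrite -sum_sqr_eq1 /adj; congr (_ == _); apply: eq_bigr => i _; rewrite !mxE.
apply: (iffP existsP) => -[a].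
  by move=> /eqP xy; exists a; rewrite -xy addrC subrK.
by move=> ->; exists a; rewrite addrAC subrr add0r.
Qed.

Lemma adj_sym d (x y : pt d) : adj x y = adj y x.
Proof. by rewrite /adj; congr (_ == _); apply: eq_bigr => i _; rewrite -sqrrN opprB. Qed.

(** Distinct steps lead to distinct neighbours, so the neighbours of [z] can be indexed by steps. *)
Lemma sum_adj (V : nmodType) d (B : {fset pt d}) (z : pt d) (F : pt d -> V) :
  \sum_(w : B | adj z (val w)) F (val w) =
  \sum_(a | z + unitv a \in B) F (z + unitv a).
Proof.
have -> : \sum_(w : B | adj z (val w)) F (val w) =
    \sum_(w : B) \sum_(a | val w == z + unitv a) F (val w).
  rewrite big_mkcond /=; apply: eq_bigr => w _; case: ifPn.
    rewrite adj_sym => /adjP[a wE]; rewrite (big_pred1 a)// => b.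
    by rewrite wE (inj_eq (addrI z)) (inj_eq (@unitv_inj d)) eq_sym.
  move=> /negP nadj; rewrite big_pred0// => a; apply/negP => /eqP wE.
  by apply: nadj; rewrite adj_sym; apply/adjP; exists a.
rewrite (exchange_big_dep predT)//= [RHS]big_mkcond /=; apply: eq_bigr => a _.
case: ifPn => [zaB|zaB]; last first.
  rewrite big_pred0// => w; apply: contraNF zaB => /eqP <-; exact: valP.
by rewrite (big_pred1 [` zaB]%fset)// => w; rewrite -val_eqE.
Qed.

(** * Appending a step to a path *)

Definition rcons_ffun (T : Type) n (s : {ffun 'I_n -> T}) (a : T) : {ffun 'I_n.+1 -> T} :=
  [ffun i => if unlift ord_max i is Some j then s j else a].

Lemma rcons_ffun_lift (T : Type) n (s : {ffun 'I_n -> T}) a (i : 'I_n) :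
  rcons_ffun s a (widen_ord (leqnSn n) i) = s i.
Proof.
rewrite ffunE (_ : widen_ord _ i = lift ord_max i) ?liftK//.
by apply: val_inj; rewrite /= /bump leqNgt ltn_ord.
Qed.

Lemma rcons_ffun_last (T : Type) n (s : {ffun 'I_n -> T}) a : rcons_ffun s a ord_max = a.
Proof. by rewrite ffunE unlift_none. Qed.

(** A path is its initial segment together with its last step; this is how conditioning on the first
    [n] steps enters. *)
Lemma big_rcons_ffun (T : finType) (V : nmodType) n (P : pred {ffun 'I_n.+1 -> T}) 
    (F : {ffun 'I_n.+1 -> T} -> V) :
  \sum_(s | P s) F s = \sum_(s : {ffun 'I_n -> T}) \sum_(a | P (rcons_ffun s a)) F (rcons_ffun s a).
Proof.
rewrite pair_big_dep /= (reindex (fun q : {ffun 'I_n -> T} * T => rcons_ffun q.1 q.2))//=.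
exists (fun s : {ffun 'I_n.+1 -> T} => ([ffun i : 'I_n => s (widen_ord (leqnSn n) i)], s ord_max)).
  move=> [s a] _ /=; rewrite rcons_ffun_last; congr (_, _); apply/ffunP => i.
  by rewrite ffunE rcons_ffun_lift.
move=> s _; apply/ffunP => i /=; rewrite ffunE; case: unliftP => [j ->|->//].
by rewrite ffunE; congr (s _); apply: val_inj; rewrite /= /bump leqNgt ltn_ord.
Qed.

Lemma walk_rcons d n (x : pt d) (s : {ffun 'I_n -> step d}) a j :
  (j <= n)%N -> walk x (rcons_ffun s a) j = walk x s j.
Proof.
move=> jn; rewrite /walk big_mkcond big_ord_recr /= ltnNge jn /= addr0.
rewrite [in RHS]big_mkcond /=; congr (_ + _); apply: eq_bigr => i _.
by rewrite rcons_ffun_lift.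
Qed.

Lemma walk_rcons_last d n (x : pt d) (s : {ffun 'I_n -> step d}) a :
  walk x (rcons_ffun s a) n.+1 = walk x s n + unitv a.
Proof.
rewrite /walk big_mkcond big_ord_recr /= ltnSn rcons_ffun_last addrA.
rewrite [in RHS]big_mkcond /=; congr (_ + _ + _); apply: eq_bigr => i _.
by rewrite rcons_ffun_lift ltn_ord ltnS ltnW.
Qed.

(** The occupation time formula, by exchanging the sums over sites and times. It serves both to
    count visits and to evaluate the exponent. *)
Lemma sum_loc (V : nmodType) d n (x : pt d) (s : {ffun 'I_n -> step d}) (D : {fset pt d}) k
    (F : pt d -> V) :
  \sum_(y : D) F (val y) *+ loc x s k (val y) =
  \sum_(j < k) (if walk x s j \in D then F (walk x s j) else 0).
Proof.
under eq_bigr do rewrite /loc -sumrMnr.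
rewrite exchange_big /=; apply: eq_bigr => j _.
transitivity (\sum_(y : D | val y == walk x s j) F (val y)).
  by rewrite [RHS]big_mkcond /=; apply: eq_bigr => y _; rewrite eq_sym; case: ifP.
case: ifPn => jD; last by rewrite big_pred0// => y; apply: contraNF jD => /eqP <-; exact: valP.
by rewrite (big_pred1 [` jD]%fset)// => y; rewrite -val_eqE.
Qed.

Lemma locDE d n (x : pt d) (s : {ffun 'I_n -> step d}) (D : {fset pt d}) k :
  locD x s D k = (\sum_(j < k) (walk x s j \in D))%N.
Proof.
have := sum_loc x s D k (fun=> 1%N); rewrite /locD => E.
rewrite (eq_bigr (fun y : D => 1 *+ loc x s k (val y))); last by move=> y _; rewrite natn.
by rewrite E; apply: eq_bigr => j _; case: ifP.
Qed.

Lemma locD_rcons d n (x : pt d) (s : {ffun 'I_n -> step d}) a (D : {fset pt d}) k :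
  (k <= n.+1)%N -> locD x (rcons_ffun s a) D k = locD x s D k.
Proof.
move=> kn; rewrite !locDE; apply: eq_bigr => j _; rewrite walk_rcons//.
by have := ltn_ord j; lia.
Qed.

(** * Stopping at the [t]-th visit to [D] *)

(** The event that tau exceeds [n]; [k.+1] runs over 1, ..., [n] because tau is an infimum over
    times at least 1. *)
Definition alive d n (x : pt d) (s : {ffun 'I_n -> step d}) (D : {fset pt d}) (t : nat) : bool :=
  [forall k : 'I_n, locD x s D k.+1 != t].

Lemma alive_rcons d n (x : pt d) (s : {ffun 'I_n -> step d}) a (D : {fset pt d}) t :
  alive x (rcons_ffun s a) D t = alive x s D t && (locD x s D n.+1 != t).
Proof.
apply/forallP/andP => [al|[/forallP al aln] k].
  split; last by have := al ord_max; rewrite locD_rcons.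
  apply/forallP => k; have := al (widen_ord (leqnSn n) k).
  by rewrite locD_rcons// ltnW// ltnS.
rewrite locD_rcons ?ltn_ord//; have [kn|nk] := ltnP k n; first exact: (al (Ordinal kn)).
by rewrite (_ : nat_of_ord k = n)//; apply/eqP; rewrite eqn_leq nk -ltnS ltn_ord.
Qed.

Lemma tau_is_alive d n (x : pt d) (s : {ffun 'I_n -> step d}) (D : {fset pt d}) t :
  tau_is x s D t n.+1 -> alive x s D t && (locD x s D n.+1 == t).
Proof.
move=> [_ [-> lt]]; rewrite eqxx andbT; apply/forallP => k; apply/eqP.
by apply: lt; rewrite // ltnS.
Qed.

(** If [S_n] were off [D], the count [t] would be reached already at time [n], against minimality;
    for [n = 0] that count is 0. *)
Lemma tau_is_last_mem d n (x : pt d) (s : {ffun 'I_n -> step d}) (D : {fset pt d}) t :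
  (0 < t)%N -> tau_is x s D t n.+1 -> walk x s n \in D.
Proof.
move=> t0 [_ [tE lt]]; apply: contraT => /negbTE nD.
have nE : locD x s D n = t by move: tE; rewrite !locDE big_ord_recr /= nD addn0.
case: n s lt tE nD nE => [|n] s lt _ _ nE; last by case: (lt n.+1 isT (ltnSn _) nE).
by move: t0; rewrite -nE locDE big_ord0.
Qed.

(** A discrete Feynman-Kac functional: for [w = exp(phi)] it is [exp(sum_{j<n} phi(S_j)) u(S_n)]. *)
Definition weighted_path (R : realType) d (w u : pt d -> R) n (x : pt d) (s : {ffun 'I_n -> step d}) : R :=
  \prod_(j < n) w (walk x s j) * u (walk x s n).

Lemma weighted_path_rcons (R : realType) d (w u : pt d -> R) n (x : pt d)
    (s : {ffun 'I_n -> step d}) a :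
  weighted_path w u x (rcons_ffun s a) =
  \prod_(j < n.+1) w (walk x s j) * u (walk x s n + unitv a).
Proof.
rewrite /weighted_path walk_rcons_last; congr (_ * _).
by apply: eq_bigr => j _; rewrite walk_rcons// -ltnS.
Qed.

Lemma optional_stopping (R : realType) d (w u : pt d -> R) (q : R) (x : pt d) (D : {fset pt d}) t N :
  0 <= q -> (forall y, 0 <= w y) -> (forall y, 0 <= u y) ->
  (forall n (s : {ffun 'I_n -> step d}), (n < N)%N ->
    w (walk x s n) * (q * \sum_a u (walk x s n + unitv a)) <= u (walk x s n)) ->
  \sum_(n < N) \sum_(s : {ffun 'I_n -> step d} | alive x s D t && (locD x s D n.+1 == t))
     q ^+ n * weighted_path w u x s <= u x.
Proof.
move=> q0 w0 u0 super.
have wp0 n (s : {ffun 'I_n -> step d}) : 0 <= q ^+ n * weighted_path w u x s.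
  by rewrite mulr_ge0 ?exprn_ge0// mulr_ge0// prodr_ge0.
(* The weight of the paths not stopped by time [n]. Stopped weight plus [rest n] equals [u x] at
   [n = 0] and does not increase with [n]. *)
pose rest n := \sum_(s : {ffun 'I_n -> step d} | alive x s D t) q ^+ n * weighted_path w u x s.
suff claim n : (n <= N)%N -> \sum_(m < n)
    \sum_(s : {ffun 'I_m -> step d} | alive x s D t && (locD x s D m.+1 == t))
     q ^+ m * weighted_path w u x s + rest n <= u x.
  by apply: le_trans (claim N _) => //; rewrite lerDl; apply: sumr_ge0.
elim: n => [_|n IHn nN].
  rewrite big_ord0 add0r /rest (big_pred1 [ffun i : 'I_0 => False_rect (step d) (notF (ltn_ord i))]).
    by rewrite expr0 mul1r /weighted_path big_ord0 mul1r /walk big_pred0 ?addr0//; case.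
  move=> s; apply/esym; rewrite /= (_ : alive _ _ _ _); last by apply/forallP; case.
  by apply/eqP/ffunP; case.
apply: le_trans (IHn (ltnW nN)); rewrite big_ord_recr /= -addrA lerD2l.
(* Surviving paths either stop at time [n.+1] or continue by one step; [super] bounds the sum over
   that step. *)
rewrite [leRHS](bigID (fun s => locD x s D n.+1 == t))/= lerD2l /rest big_rcons_ffun.
rewrite [leRHS]big_mkcond /=; apply: ler_sum => s _.
under eq_bigl do rewrite alive_rcons.
case: ifP => _; last by rewrite big_pred0.
under eq_bigr do rewrite weighted_path_rcons big_ord_recr /= exprS.
rewrite /weighted_path.
have -> : \sum_a q * q ^+ n * (\prod_(j < n) w (walk x s j) * w (walk x s n) * u (walk x s n + unitv a))
  = q ^+ n * \prod_(j < n) w (walk x s j) * (w (walk x s n) * (q * \sum_a u (walk x s n + unitv a))).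
  by rewrite !mulr_sumr; apply: eq_bigr => a _; ring.
by rewrite [leRHS]mulrA ler_wpM2l ?super// mulr_ge0 ?exprn_ge0 ?prodr_ge0.
Qed.

(** * Finite boxes and the killed walk *)

Definition fnbhd d (A : {fset pt d}) : {fset pt d} :=
  (A `|` [fset z in [seq (x + unitv a)%R | x <- enum_fset A, a <- enum {: step d}]])%fset.

Lemma in_fnbhd d (A : {fset pt d}) (z : pt d) :
  (z \in fnbhd A) = (z \in A) || [exists a, z - unitv a \in A].
Proof.
rewrite in_fsetU in_fset; congr (_ || _); apply/allpairsP/existsP => [[[x a] [/= xA _ ->]]|[a zA]].
  by exists a; rewrite addrK.
by exists (z - unitv a, a); rewrite subrK mem_enum.
Qed.

Lemma fnbhdE d (D : {fset pt d}) (z : pt d) : z \in fnbhd D <-> Dbar D z.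
Proof.
rewrite in_fnbhd; split => [/orP[zD|/existsP[a zD]]|[->//|[y yD /adjP[a zE]]]].
- by left.
- by right; exists (z - unitv a) => //; apply/adjP; exists a; rewrite subrK.
- by apply/orP; right; apply/existsP; exists a; rewrite zE addrK.
Qed.

Lemma fnbhd_step d (A : {fset pt d}) (z : pt d) a : z \in A -> z + unitv a \in fnbhd A.
Proof. by move=> zA; rewrite in_fnbhd; apply/orP; right; apply/existsP; exists a; rewrite addrK. Qed.

Lemma sub_fnbhd d (A : {fset pt d}) : (A `<=` fnbhd A)%fset.
Proof. exact: fsubsetUl. Qed.

Lemma sub_iter_fnbhd d (A : {fset pt d}) n : (A `<=` iter n (@fnbhd d) A)%fset.
Proof. by elim: n => //= n /fsubset_trans; apply; exact: sub_fnbhd. Qed.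

Lemma walk_in_iter d (A : {fset pt d}) n (x : pt d) (s : {ffun 'I_n -> step d}) j :
  x \in A -> (j <= n)%N -> walk x s j \in iter j (@fnbhd d) A.
Proof.
move=> xA; elim: j => [_|j IHj jn]; first by rewrite /walk big_pred0 ?addr0.
suff -> : walk x s j.+1 = walk x s j + unitv (s (Ordinal jn)).
  by apply: fnbhd_step; apply: IHj; exact: ltnW.
rewrite /walk -addrA; congr (_ + _); rewrite (bigD1 (Ordinal jn))//= addrC; congr (_ + _).
by apply: eq_bigl => i; rewrite -val_eqE /=; lia.
Qed.

Lemma sum_fincl (V : nmodType) (K : choiceType) (A B : {fset K}) (AB : (A `<=` B)%fset) (F : B -> V) :
  \sum_(i | val i \in A) F i = \sum_(y : A) F (fincl AB y).
Proof.
transitivity (\sum_(i : B) \sum_(y : A | i == fincl AB y) F i).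
  rewrite big_mkcond /=; apply: eq_bigr => i _; case: ifPn => iA.
    by rewrite (big_pred1 [` iA]%fset)// => y; rewrite -val_eqE /= -val_eqE /= eq_sym.
  by rewrite big_pred0// => y; apply: contraNF iA => /eqP ->; exact: (valP y).
by rewrite (exchange_big_dep predT)//=; apply: eq_bigr => y _; rewrite big_pred1_eq.
Qed.

(** The value 0 outside [B] expresses killing: steps that leave [B] contribute nothing. *)
Definition zero_ext (R : nmodType) (K : choiceType) (B : {fset K}) (u : B -> R) (z : K) : R :=
  if insub z is Some i then u i else 0.

Lemma zero_ext_val (R : nmodType) (K : choiceType) (B : {fset K}) (u : B -> R) (i : B) :
  zero_ext u (val i) = u i.
Proof. by rewrite /zero_ext valK. Qed.

Lemma zero_ext_notin (R : nmodType) (K : choiceType) (B : {fset K}) (u : B -> R) (z : K) :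
  z \notin B -> zero_ext u z = 0.
Proof. by move=> zB; rewrite /zero_ext insubN. Qed.

Definition srw_kernel (R : realType) d (B : {fset pt d}) (i j : B) : R :=
  (2 * d)%:R^-1 * (adj (val i) (val j))%:R.
Arguments srw_kernel R {d} B i j.

Lemma srw_kernelE (R : realType) d (B : {fset pt d}) (u : B -> R) (i : B) :
  \sum_j srw_kernel R B i j * u j = (2 * d)%:R^-1 * \sum_a zero_ext u (val i + unitv a).
Proof.
under eq_bigr do rewrite -mulrA.
rewrite -mulr_sumr; congr (_ * _).
transitivity (\sum_(j : B | adj (val i) (val j)) zero_ext u (val j)).
  rewrite [RHS]big_mkcond /=; apply: eq_bigr => j _.
  by rewrite zero_ext_val; case: (adj _ _); rewrite ?mul1r ?mul0r.
rewrite sum_adj big_mkcond /=; apply: eq_bigr => a _.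
by case: ifPn => // /zero_ext_notin ->.
Qed.

Lemma srw_kernel_sum_le1 (R : realType) d (B : {fset pt d}) (i : B) :
  \sum_j srw_kernel R B i j <= 1.
Proof.
rewrite -mulr_sumr.
have -> : \sum_(j : B) (adj (val i) (val j))%:R = \sum_(j : B | adj (val i) (val j)) 1 :> R.
  by rewrite [RHS]big_mkcond /=; apply: eq_bigr => j _; case: (adj _ _).
rewrite (sum_adj B (val i) (fun=> 1)).
have le2d : \sum_(a | val i + unitv a \in B) 1 <= (2 * d)%:R :> R.
  rewrite sumr_const ler_nat (leq_trans (max_card _))//.
  by rewrite card_prod card_ord card_bool mulnC.
(* In the degenerate case the inverse of 0 is 0 by convention. *)
have [d0|d0] := eqVneq ((2 * d)%:R : R) 0; first by rewrite d0 invr0 mul0r ler01.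
by rewrite mulrC ler_pdivrMr ?mul1r// lt_neqAle eq_sym d0 ler0n.
Qed.

(** * Probability vectors in [C] *)

(** At the stopping time the total local time on [D] is exactly [t], so the normalised profile has
    mass 1 and lies in this part of [C]. *)
Definition simplex_part (R : realType) d (D : {fset pt d}) (C : set {ffun D -> R}) : set {ffun D -> R} :=
  [set k | [/\ C k, forall y, 0 <= k y & \sum_y k y = 1]].

Lemma event_occupation (R : realType) d (D : {fset pt d}) (C : set {ffun D -> R}) t
    (x : pt d) n (s : {ffun 'I_n -> step d}) :
  (0 < t)%N -> event C t x s ->
  simplex_part C [ffun y : D => (loc x s n.+1 (fsval y))%:R / t%:R].
Proof.
move=> t0 [[_ [tE _]] Ck]; split => // [y|]; first by rewrite ffunE divr_ge0.
under eq_bigr do rewrite ffunE.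
by rewrite -mulr_suml -natr_sum -[X in X%:R]/(locD x s D n.+1) tE divff// pnatr_eq0 -lt0n.
Qed.

(** The variational problem lives on the box [B], so vectors on [D] are continued by 0. *)
Definition lift_simplex (R : realType) d (D B : {fset pt d}) (DB : (D `<=` B)%fset)
  (C : set {ffun D -> R}) : set (B -> R) :=
  [set k | simplex_part C [ffun y => k (fincl DB y)] /\ forall i, val i \notin D -> k i = 0].

(** By contraposition: if [g] has arbitrarily close members of the set, each defining condition
    passes to the limit. *)
Lemma lift_simplex_closed (R : realType) d (D B : {fset pt d}) (DB : (D `<=` B)%fset)
    (C : set {ffun D -> R}) (g : B -> R) :
  l1_closed C -> ~ lift_simplex DB C g ->
  exists2 e : R, 0 < e & forall f, \sum_i `|f i - g i| < e -> ~ lift_simplex DB C f.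
Proof.
move=> Ccl; apply: contra_notP => noe.
have approx e : 0 < e -> exists2 f, lift_simplex DB C f & \sum_i `|f i - g i| < e.
  move=> e0; apply: contra_notP noe => nof; exists e => // f fe Kf.
  by apply: nof; exists f.
have coord (f : B -> R) i : `|f i - g i| <= \sum_i `|f i - g i|.
  by rewrite (bigD1 i)//= lerDl; apply: sumr_ge0.
have sumD (f : B -> R) : \sum_(y : D) `|f (fincl DB y) - g (fincl DB y)| <= \sum_i `|f i - g i|.
  rewrite -(sum_fincl DB (fun i => `|f i - g i|)) big_mkcond /=.
  by apply: ler_sum => i _; case: ifP.
split => [|i iD]; first split.
- apply: contrapT => /Ccl[e e0 nC]; have [f [[Cf _ _] _] fe] := approx _ e0.
  apply: nC Cf; apply: le_lt_trans fe; apply: le_trans (sumD f).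
  by apply: ler_sum => y _; rewrite !ffunE.
- move=> y; rewrite ffunE; apply/ler_addgt0Pr => e e0.
  have [f [[_ f0 _] _] fe] := approx _ e0; have := f0 y; rewrite ffunE.
  have := le_lt_trans (coord f (fincl DB y)) fe; rewrite ltr_norml => /andP[]; lra.
- apply/eqP; rewrite -subr_eq0 -normr_le0; apply/ler_addgt0Pr => e e0.
  have [f [[_ _ f1] _] fe] := approx _ e0; rewrite add0r -f1 distrC -sumrB.
  apply: le_trans (ltW fe); apply: le_trans (sumD f).
  apply: le_trans (ler_norm_sum _ _ _) _.
  by apply: ler_sum => y _; rewrite !ffunE.
- apply/eqP; rewrite -normr_le0; apply/ler_addgt0Pr => e e0.
  have [f [_ f0] fe] := approx _ e0; have := le_lt_trans (coord f i) fe.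
  by rewrite (f0 _ iD) sub0r normrN add0r => /ltW.
Qed.

Lemma lift_simplex_convex (R : realType) d (D B : {fset pt d}) (DB : (D `<=` B)%fset)
    (C : set {ffun D -> R}) (k l : B -> R) (s : R) :
  l1_convex C -> lift_simplex DB C k -> lift_simplex DB C l -> 0 <= s -> s <= 1 ->
  lift_simplex DB C (fun i => s * k i + (1 - s) * l i).
Proof.
move=> Ccvx [[Ck k0 k1] kD] [[Cl l0 l1] lD] s0 s1; split => [|i iD]; last first.
  by rewrite kD// lD// !mulr0 addr0.
split => [|y|].
- have := Ccvx _ _ s Ck Cl s0 s1; congr C.
  by apply/ffunP => y; rewrite !ffunE.
- have := k0 y; have := l0 y; rewrite !ffunE => ? ?.
  by rewrite addr_ge0// mulr_ge0// subr_ge0.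
- move: k1 l1; under eq_bigr do rewrite ffunE; move=> k1.
  under eq_bigr do rewrite ffunE; move=> l1; under eq_bigr do rewrite ffunE.
  by rewrite big_split -!mulr_sumr /= k1 l1 !mulr1 addrC subrK.
Qed.

Lemma lift_simplex_fincl (R : realType) d (D B : {fset pt d}) (DB : (D `<=` B)%fset)
    (C : set {ffun D -> R}) (k : {ffun D -> R}) :
  simplex_part C k -> lift_simplex DB C (fun i => zero_ext k (val i)).
Proof.
move=> Kk; split => [|i iD]; last by rewrite zero_ext_notin.
rewrite (_ : [ffun y => _] = k)//; apply/ffunP => y.
by rewrite ffunE /= zero_ext_val.
Qed.

(** * The upper bound *)

(** Truncation at [N] confines the walk to a finite box, where the variational problem applies. The
    starting point may depend on [N] and [eps]. *)
Lemma truncated_bound (R : realType) d (D : {fset pt d}) (C : set {ffun D -> R})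
    (t N : nat) (e0 eps : R) :
  (0 < d)%N -> D != fset0 -> l1_closed C -> l1_convex C -> (0 < t)%N ->
  (forall k, C k -> (forall y, 0 <= k y) -> e0 <= 2^-1 * energy (sqrtf k)) ->
  0 < eps ->
  exists2 x, Dbar D x &
    \sum_(n < N) \sum_(s : {ffun 'I_n -> step d} | `[< event C t x s >])
      (2 * d)%:R ^- n <= expR (- (t%:R * (e0 - eps))).
Proof.
move=> d0 /fset0Pn[y0 y0D] Ccl Ccvx t0 Ce eps0.
(* If [C] has no probability vector the event is impossible and any start will do. *)
have [[k0 Kk0]|noK] := pselect (simplex_part C !=set0); last first.
  exists y0; first by left.
  rewrite big1 ?expR_ge0// => n _; rewrite big_pred0// => s.
  by apply/negP => /asboolP /(event_occupation t0) Ks; apply: noK; eexists; exact: Ks.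
pose q : R := (2 * d)%:R^-1.
have q0 : 0 < q by rewrite invr_gt0 ltr0n muln_gt0.
(* Every path of at most [N] steps from the closure of [D] stays in [B]. *)
pose B := iter N (@fnbhd d) (fnbhd D).
have DbarB : (fnbhd D `<=` B)%fset by exact: sub_iter_fnbhd.
have DB : (D `<=` B)%fset by apply: fsubset_trans DbarB; exact: sub_fnbhd.
pose I : finType := B.
pose D' : {set I} := [set i | val i \in D]%SET.
have sumD' (F : I -> R) : \sum_(i in D') F i = \sum_(y : D) F (fincl DB y).
  by rewrite -(sum_fincl DB); apply: eq_bigl => i; rewrite inE.
have [||||||||||u [u0 uD uout usep]] := @superharmonic_separation R I (srw_kernel R B) D'
    (lift_simplex DB C) e0 eps.
- by move=> i j; rewrite /srw_kernel adj_sym.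
- by move=> i j; rewrite mulr_ge0// invr_ge0.
- exact: srw_kernel_sum_le1.
- by exists (fun i => zero_ext k0 (val i)); exact: lift_simplex_fincl.
- by move=> g; exact: lift_simplex_closed.
- by move=> k l s; exact: lift_simplex_convex.
- move=> k i [[_ k_ge0 k_sum1] kout].
  have [iD|iD] := boolP (val i \in D); last by rewrite kout// lexx ler01.
  have <- : [ffun y => k (fincl DB y)] [` iD]%fset = k i.
    by rewrite ffunE; congr k; exact: val_inj.
  rewrite k_ge0 -k_sum1 (bigD1 [` iD]%fset)//= lerDl.
  by apply: sumr_ge0.
- by move=> k i [_ kout]; rewrite inE; exact: kout.
- move=> k [[Ck k_ge0 _] _]; apply: le_trans (Ce _ Ck k_ge0) _.
  rewrite ler_wpM2l ?invr_ge0// /energy mulr_sumr sumD'; apply: ler_sum => y _.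
  rewrite mulr_sumr sumD' big_mkcond /=; apply: ler_sum => z _.
  rewrite !ffunE /srw_kernel /=.
  by case: (adj _ _); rewrite ?mulr1// mulr0 mul0r.
- exact: eps0.
pose U := zero_ext u.
pose PU y := q * \sum_a U (y + unitv a).
have PuE (i : I) : \sum_j srw_kernel R B i j * u j = PU (val i) by exact: srw_kernelE.
have UE y (yB : y \in B) : U y = u [` yB]%fset by rewrite -zero_ext_val.
have U0 y : 0 <= U y.
  by have [yB|yB] := boolP (y \in B); [rewrite UE|rewrite /U zero_ext_notin].
have PU0 y : 0 <= PU y by rewrite mulr_ge0 ?sumr_ge0// ltW.
have UD y : y \in D -> 0 < U y.
  by move=> yD; rewrite (UE _ (fsubsetP DB _ yD)) uD// inE.
have Uout y : y \in B -> y \notin D -> PU y <= U y.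
  by move=> yB yD; rewrite (UE _ yB) -(PuE [` yB]%fset) uout// inE.
pose phi y := 1 - PU y / U y.
pose w y := if y \in D then expR (phi y) else 1.
have w0 y : 0 <= w y by rewrite /w; case: ifP => _; rewrite ?expR_ge0.
(* On [D] this is [x * exp(1 - x) <= 1] for [x = PU y / U y]. *)
have super y : y \in B -> w y * PU y <= U y.
  move=> yB; rewrite /w; case: ifPn => yD; last by rewrite mul1r Uout.
  have -> : phi y = - (PU y / U y - 1) by rewrite opprB.
  rewrite expRN mulrC ler_pdivrMr ?expR_gt0//.
  rewrite -[leLHS](divfK (lt0r_neq0 (UD _ yD))) mulrC ler_wpM2l//.
  by have := expR_ge1Dx (PU y / U y - 1); rewrite addrC subrK.
have y0nb : y0 \in fnbhd D by exact: (fsubsetP (sub_fnbhd D)).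
have [x _ xmin] := @Order.TotalTheory.arg_minP _ R _ [` y0nb]%fset predT (fun z : fnbhd D => U (val z)) isT.
(* A boundary point has a neighbour in [D], where [U] is positive; superharmonicity carries
   positivity over. *)
have Ux0 : 0 < U (val x).
  have [xD|xD] := boolP (val x \in D); first exact: UD.
  have xB : val x \in B by exact: (fsubsetP DbarB _ (valP x)).
  apply: lt_le_trans (Uout _ xB xD).
  have := valP x; rewrite in_fnbhd (negbTE xD) /= => /existsP[a xaD].
  have opp_a : - unitv a = unitv (a.1, ~~ a.2).
    by apply/rowP => i; rewrite mxE !unitvE /=; case: (i == _); case: a.2; rewrite ?oppr0 ?opprK.
  rewrite mulr_gt0// (bigD1 (a.1, ~~ a.2))//= -opp_a ltr_pwDl ?UD// sumr_ge0//.
exists (val x); first exact/fnbhdE/valP.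
(* All neighbours of a point of [D] lie in the closure, over which [val x] minimises [U]. *)
have PUx y : y \in D -> U (val x) <= PU y.
  move=> yD; rewrite /PU ler_pdivlMl ?ltr0n ?muln_gt0//.
  have -> : (2 * d)%:R * U (val x) = \sum_(a : step d) U (val x).
    by rewrite sumr_const card_prod card_ord card_bool mulnC -[in RHS]mulr_natl.
  by apply: ler_sum => a _; exact: (xmin [` fnbhd_step a yD]%fset).
have stopped : \sum_(n < N) \sum_(s : {ffun 'I_n -> step d} | alive (val x) s D t && (locD (val x) s D n.+1 == t))
     q ^+ n * weighted_path w U (val x) s <= U (val x).
  apply: optional_stopping => //; first exact: ltW.
  move=> n s nN; apply: super; rewrite /B -(subnK (ltnW nN)) iterD.
  exact: (fsubsetP (sub_iter_fnbhd _ _)) (walk_in_iter _ (valP x) (leqnn n)).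
(* After multiplication by [U (val x)] and the exponential, the bound is compared with [stopped]
   path by path. *)
rewrite -(ler_pM2r Ux0) expRN ler_pdivlMl ?expR_gt0//.
apply: le_trans stopped.
rewrite mulrA mulr_sumr mulr_suml; apply: ler_sum => n _.
rewrite mulr_sumr mulr_suml big_mkcond [leRHS]big_mkcond /=; apply: ler_sum => s _.
case: asboolP => [ev|_]; last first.
  case: ifP => _ //; rewrite mulr_ge0 ?exprn_ge0 ?(ltW q0)//.
  by rewrite mulr_ge0// prodr_ge0.
have [tau_s _] := ev; rewrite tau_is_alive//.
rewrite -exprVn -/q -mulrA mulrCA ler_wpM2l ?exprn_ge0 ?(ltW q0)//.
have SnD := tau_is_last_mem t0 tau_s.
have SnB := fsubsetP DB _ SnD.
(* Since [S_n] is in [D], [w(S_n) U(x) <= w(S_n) PU(S_n) <= U(S_n)]: this adds the factor of the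
   last visit, so that all [t] visits are counted. *)
apply: (@le_trans _ _ (\prod_(j < n.+1) w (walk (val x) s j) * U (val x))); last first.
  rewrite big_ord_recr /= -mulrA ler_wpM2l ?prodr_ge0//.
  by apply: le_trans (super _ SnB); rewrite ler_wpM2l// PUx.
rewrite ler_wpM2r//.
have -> : \prod_(j < n.+1) w (walk (val x) s j) =
    expR (\sum_(y : D) phi (val y) *+ loc (val x) s n.+1 (val y)).
  rewrite sum_loc expR_sum; apply: eq_bigr => j _.
  by rewrite /w; case: ifP => //; rewrite expR0.
rewrite ler_expR -ler_pdivlMl ?ltr0n// mulr_sumr.
have := usep _ (lift_simplex_fincl DB (event_occupation t0 ev)).
rewrite sumD' => /le_trans; apply; apply: ler_sum => y _.
rewrite PuE /= zero_ext_val ffunE -mulr_natl -(UE _ (fsubsetP DB _ (valP y))).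
by rewrite /phi; lra.
Qed.

Unset Implicit Arguments.

(** By contradiction: if every start exceeded the bound by [c], a single truncation would already
    show it, because the closure of [D] is finite. For empty [D] the left side would be an infimum
    over the empty set, hence infinite. *)
Theorem theorem1p4 (R : realType) (d : nat) (D : {fset 'rV[int]_d})
  (C : set {ffun D -> R}) (t : nat) :
  (3 <= d)%N -> D != fset0 ->
  l1_closed C -> l1_convex C -> (1 <= t)%N ->
  (ereal_inf [set Pevent C t x | x in Dbar D] <=
   expeR (- (t%:R)%:E *
     ereal_inf [set ((2 : R)^-1 * energy (sqrtf h))%:E
               | h in [set h : {ffun D -> R} | C h /\ forall y, (0 <= h y)%R]]))%E.
Proof.
move=> d3 D0 Ccl Ccvx t0.
have d0 : (0 < d)%N by exact: leq_trans d3.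
set E := ereal_inf [set ((2 : R)^-1 * energy (sqrtf h))%:E | h in _].
pose a x n : R := \sum_(s : {ffun 'I_n -> step d} | `[< event C t x s >]) (2 * d)%:R ^- n.
have a0 x n : 0 <= a x n by apply: sumr_ge0 => s _; rewrite invr_ge0 exprn_ge0.
have PE x : Pevent C t x = (\sum_(n <oo) (a x n)%:E)%E.
  by apply: eq_eseriesr => n _; rewrite -sumEFin.
(* With no nonnegative function in [C] the event has probability 0, which is below any
   exponential. *)
have [[h0 [Ch0 h00]]|noC] := pselect ([set h : {ffun D -> R} | C h /\ forall y, 0 <= h y] !=set0); last first.
  have [y0 y0D] := fset0Pn _ D0.
  apply: (@le_trans _ _ 0%E); last exact: expeR_ge0.
  apply: ge_ereal_inf; exists (Pevent C t y0); first by exists y0 => //; left.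
  rewrite PE eseries0// => n _ _; rewrite /a big_pred0// => s.
  apply/negP => /asboolP /(event_occupation t0)[Ck k0 _]; apply: noC; eexists; split; [exact: Ck|exact: k0].
have E0 : (0 <= E)%E.
  apply: le_ereal_inf_tmp => _ [h _ <-]; rewrite lee_fin mulr_ge0 ?invr_ge0//.
  rewrite mulr_ge0 ?invr_ge0//; apply: sumr_ge0 => y _; apply: sumr_ge0 => z _; exact: sqr_ge0.
have Efin : E \is a fin_num.
  rewrite ge0_fin_numE//; apply: (@le_lt_trans _ _ (2^-1 * energy (sqrtf h0))%:E); last exact: ltry.
  by apply: ereal_inf_lbound; exists h0.
rewrite -(fineK Efin) -EFinN -EFinM /=; set e0 := fine E.
have e0_le k : C k -> (forall y, 0 <= k y) -> e0 <= 2^-1 * energy (sqrtf k).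
  move=> Ck k0; rewrite -lee_fin /e0 fineK//.
  by apply: ereal_inf_lbound; exists k.
apply/lee_addgt0Pr => c c0; rewrite -EFinD leNgt; apply/negP => inf_gt.
pose b := expR (- t%:R * e0) + c.
have b_gt : expR (- t%:R * e0) < b by rewrite ltrDl.
have b0 : 0 < b by apply: lt_trans b_gt; exact: expR_gt0.
(* A series above [b] has a partial sum above [b]; [Nf x] is such a horizon for the start [x]. *)
have /choice[Nf NfP] : forall x, exists N, Dbar D x -> b < \sum_(0 <= n < N) a x n.
  move=> x; apply: contrapT => noN.
  have {}noN N : Dbar D x /\ \sum_(0 <= n < N) a x n <= b.
    have [] := pselect (Dbar D x /\ \sum_(0 <= n < N) a x n <= b) => // nle; exfalso.
    by apply: noN; exists N => Dx; rewrite ltNge; apply/negP => le_b; apply: nle.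
  have [Dx _] := noN 0%N.
  have : (Pevent C t x <= b%:E)%E.
    rewrite PE; apply: lime_le; first by apply: is_cvg_nneseries => n _ _; rewrite lee_fin.
    by apply: nearW => N; rewrite sumEFin lee_fin; have [] := noN N.
  apply/negP; rewrite -ltNge; apply: lt_le_trans inf_gt _.
  by apply: ereal_inf_lbound; exists x.
(* Partial sums increase with the horizon, so the maximum serves all starts at once. *)
pose N := \max_(z : fnbhd D) Nf (val z).
have t_gt0 : 0 < t%:R :> R by rewrite ltr0n.
(* Chosen so that [exp(-t (e0 - eps)) = b]; it is positive because [b] exceeds [exp(-t e0)]. *)
pose eps := ln b / t%:R + e0.
have eps0 : 0 < eps.
  rewrite -(pmulr_rgt0 _ t_gt0) mulrDr mulrCA divff ?gt_eqF// mulr1.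
  have : - t%:R * e0 < ln b by rewrite -ltr_expR lnK.
  by rewrite mulNr -subr_gt0 opprK.
have [x Dx] := truncated_bound N d0 D0 Ccl Ccvx t0 e0_le eps0.
have -> : expR (- (t%:R * (e0 - eps))) = b.
  rewrite /eps opprD addrCA subrr addr0 mulrN opprK mulrCA divff ?gt_eqF// mulr1.
  exact: lnK.
apply/negP; rewrite -ltNge; apply: lt_le_trans (NfP _ Dx) _.
rewrite -(big_mkord xpredT (fun n => a x n)).
have xnb : x \in fnbhd D by exact/fnbhdE.
have leN : (Nf x <= N)%N by exact: (leq_bigmax [` xnb]%fset).
rewrite (big_cat_nat (leq0n _) leN)//= lerDl; exact: sumr_ge0.
Qed.
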